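(* Let $K=\mathbf{R}$ or $K=\mathbf{C}$, let $X$ be a normed $K$-linear space with norm $\|\cdot\|$, and for each $y\in X$ with $\|y\|=1$ let $p_y:X\to\mathbf{R}$ be defined by $$p_y(x)=\sqrt{\tfrac12\left(\|x+y\|^2+\|x-y\|^2\right)-1}.$$ Then the following statements are equivalent. (i) For all $y\in X$ with $\|y\|=1$, $p_y$ is homogeneous. (ii) For all $y\in X$ with $\|y\|=1$, $p_y(x)=\|x\|$ for all $x\in X$. (iii) $\|\cdot\|$ is induced from an inner product on $X$.
   Context: A function $p:X\to\mathbf{R}$ is called homogeneous if $p(\lambda x)=|\lambda|\,p(x)$ for all $\lambda\in K$ and all $x\in X$. The function $p_y$ is well-defined because $\frac12(\|x+y\|^2+\|x-y\|^2)-1\ge 0$ for all $x\in X$ whenever $\|y\|=1$. The norm is induced from an inner product $\langle\cdot,\cdot\rangle:X\times X\to K$ if $\|x\|^2=\langle x,x\rangle$ for all $x\in X$. *)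

(* Defs.v *)
From mathcomp Require Import all_boot all_order all_algebra sesquilinear.
From mathcomp Require Import all_classical reals topology normedtype.
From mathcomp Require Import complex.

Set Implicit Arguments.
Unset Strict Implicit.
Unset Printing Implicit Defensive.

Import Order.TTheory GRing.Theory Num.Theory.
Local Open Scope ring_scope.

(* The norm of a [normedModType K] and the absolute value of [K] take their
   values in [K], among the nonnegative reals of [K].  They are read as
   elements of [R] through [toR : K -> R], which is the identity for [K = R]
   and the real part for [K = R[i]]. *)
Section NormedSpace.
Variables (R : realType) (K : numFieldType) (toR : K -> R).
Variable X : normedModType K.

Definition rnorm (x : X) : R := toR `|x|.

Definition homogeneous (p : X -> R) : Prop :=
  forall (l : K) (x : X), p (l *: x) = toR `|l| * p x.

(* [Num.sqrt] is 0 on negative arguments, but if [rnorm y = 1] then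
   2 = rnorm ((x + y) - (x - y)) <= rnorm (x + y) + rnorm (x - y),
   so the argument is nonnegative. *)
Definition pfun (y x : X) : R :=
  Num.sqrt ((rnorm (x + y) ^+ 2 + rnorm (x - y) ^+ 2) / 2 - 1).

End NormedSpace.

(* [{dot X for conj}]: forms X -> X -> K that are K-linear in the first
   argument, conj-linear in the second, conj-symmetric and positive definite;
   [conj] is the identity for [K = R] and the conjugation for [K = R[i]]. *)
Definition induced_by_inner_product (K : numFieldType) (conj : K -> K)
    (X : normedModType K) : Prop :=
  exists dot : {dot X for conj}, forall x : X, `|x| ^+ 2 = dot x x.

(* Main.v *)
Require Import Defs.
From mathcomp Require Import all_boot all_order all_algebra sesquilinear.
From mathcomp Require Import all_classical reals topology normedtype.
From mathcomp Require Import complex.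
From HB Require Import structures.
From mathcomp Require Import ring lra.

Set Implicit Arguments.
Unset Strict Implicit.
Unset Printing Implicit Defensive.

Import Order.TTheory GRing.Theory Num.Theory.
Local Open Scope ring_scope.

(** Write N for the norm and p_y for the function attached to a unit vector y,
    so that p_y(x)^2 = (N(x + y)^2 + N(x - y)^2) / 2 - 1.

    If p_y is homogeneous, then p_y(x) = p_y(t x) / t for every t > 0, and the
    triangle inequality pins N(t x + y) and N(t x - y) between |t N(x) - 1| and
    t N(x) + 1; this leaves |p_y(x)^2 - N(x)^2| <= 2 N(x) / t, and t may be
    taken arbitrarily large ([homogeneous_pfun]).  Conversely N itself is
    homogeneous.

    The equality p_y = N for a unit vector y is the parallelogram law for the
    pairs (x, y), and dividing a pair by N(y) gives the law for all pairs
    ([pfun_parallelogram], [parallelogram_pfun]).  It remains to see that the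
    parallelogram law characterises inner product norms, the theorem of Jordan
    and von Neumann.  Its nontrivial half takes the polar form
    P(x, y) = (N(x + y)^2 - N(x - y)^2) / 4, which the law makes additive in x
    ([polarDl]).  By the triangle inequality |P(x, y)| <= N(x) N(y), and an
    additive function that is bounded by a multiple of the absolute value is
    linear over the reals ([additive_bounded_linear]).  Over the reals P is the
    inner product; over the complex numbers P is its real part, and the inner
    product is P(x, y) + i P(x, i y).

    Both scalar fields are treated at once: the arguments up to the real
    linearity of P use only an embedding [ofR] of the reals into the scalar
    field K whose image contains the nonnegative elements of K. *)

(** * Additive functions of linear growth *)

Lemma natmul_bounded_le0 (R : archiRealFieldType) (d c : R) :
  (forall n : nat, d * n.+1%:R <= c) -> d <= 0.
Proof.
move=> bnd; rewrite leNgt; apply/negP => d0.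
have := bnd (Num.truncn (c / d)); apply/negP.
rewrite -ltNge mulrC -ltr_pdivrMr //.
exact: truncnS_gt.
Qed.

(** The defect f t - t * f 1 is additive in t and vanishes at the integers, so
    its n-th multiple is its value at the fractional part of n t; it is thus
    bounded independently of n. *)
Lemma additive_bounded_linear (R : archiRealFieldType) (f : R -> R) (C : R) :
    {morph f : s t / s + t} -> (forall t, `|f t| <= C * `|t|) ->
  forall t, f t = t * f 1.
Proof.
move=> fD fC t.
have f0 : f 0 = 0 by apply: (addrI (f 0)); rewrite -fD !addr0.
have fN s : f (- s) = - f s.
  by apply: (addrI (f s)); rewrite -fD !subrr f0.
have fMn s n : f (s *+ n) = f s *+ n.
  by elim: n => [|n IH]; rewrite ?mulr0n // !mulrS fD IH.
have fz (m : int) : f m%:~R = m%:~R * f 1.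
  by case: m => m; rewrite ?NegzE ?mulrNz ?fN -pmulrn fMn ?mulNr mulr_natl.
apply/eqP; rewrite -subr_eq0 -normr_le0.
apply: (@natmul_bounded_le0 _ _ (C + `|f 1|)) => n.
have /andP[m_le m_gt] := floor_itv (t *+ n.+1).
set m := Num.floor _ in m_le m_gt; set e := t *+ n.+1 - m%:~R.
have e0 : 0 <= e by rewrite subr_ge0.
have e1 : e <= 1 by rewrite lerBlDl -intrD1 ltW.
have -> : `|f t - t * f 1| * n.+1%:R = `|f e - e * f 1|.
  have -> : f e = f t *+ n.+1 - m%:~R * f 1 by rewrite fD fN fz fMn.
  rewrite -[X in _ * X = _](@ger0_norm _ (n.+1%:R)) // -normrM.
  by congr `|_|; rewrite /e -[f t *+ _]mulr_natr -[t *+ _]mulr_natr; ring.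
have C0 : 0 <= C by have := le_trans (normr_ge0 _) (fC 1); rewrite normr1 mulr1.
apply: le_trans (ler_normB _ _) _; apply: lerD.
  by apply: le_trans (fC e) _; rewrite ger0_norm // ler_piMr.
by rewrite normrM ger0_norm // ler_piMl.
Qed.

(** * The real-valued norm *)

Section RealScalars.
Variables (R : realType) (K : numFieldType).
Variables (ofR : {rmorphism R -> K}) (toR : K -> R).
Hypothesis ofRK : cancel ofR toR.
Hypothesis toRK : forall k : K, 0 <= k -> ofR (toR k) = k.
Hypothesis ofR_ge0 : forall t, (0 <= ofR t) = (0 <= t).
Variable X : normedModType K.
Local Notation N := (rnorm toR (X := X)).
Implicit Types x y z : X.

Lemma ofR_rnorm x : ofR (N x) = `|x|.
Proof. exact: toRK. Qed.

Lemma ler_ofR s t : (ofR s <= ofR t) = (s <= t).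
Proof. by rewrite -subr_ge0 -rmorphB ofR_ge0 subr_ge0. Qed.

Lemma rnorm_ge0 x : 0 <= N x.
Proof. by rewrite -ofR_ge0 ofR_rnorm. Qed.

Lemma ler_rnormD x y : N (x + y) <= N x + N y.
Proof. by rewrite -ler_ofR rmorphD !ofR_rnorm ler_normD. Qed.

Lemma rnormZ k x : N (k *: x) = toR `|k| * N x.
Proof.
rewrite /rnorm normrZ -[in LHS]ofR_rnorm -(toRK (normr_ge0 k)).
by rewrite -rmorphM !ofRK.
Qed.

Lemma toR_norm_ofR t : toR `|ofR t| = `|t|.
Proof.
have [t0|/ltW t0] := leP 0 t.
  by rewrite ger0_norm ?ofR_ge0 ?ofRK // ger0_norm.
rewrite ler0_norm -?rmorphN ?ofRK ?ler0_norm //.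
by rewrite -oppr_ge0 -rmorphN ofR_ge0 oppr_ge0.
Qed.

Lemma rnormZr t x : N (ofR t *: x) = `|t| * N x.
Proof. by rewrite rnormZ toR_norm_ofR. Qed.

Lemma rnormN x : N (- x) = N x.
Proof. by rewrite /rnorm normrN. Qed.

Lemma rnormB x y : N (x - y) = N (y - x).
Proof. by rewrite -rnormN opprB. Qed.

Lemma rnorm0 : N (0 : X) = 0.
Proof. by rewrite /rnorm normr0 -(rmorph0 ofR) ofRK. Qed.

Lemma rnorm_eq0 x : N x = 0 -> x = 0.
Proof. by move=> x0; apply/eqP; rewrite -normr_eq0 -ofR_rnorm x0 rmorph0. Qed.

(** The direct and reverse triangle inequalities, squared because p_y and the
    polar form involve norms of sums only through their squares. *)
Lemma rnormD_sqr_bounds x y :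
  (N x - N y) ^+ 2 <= N (x + y) ^+ 2 <= (N x + N y) ^+ 2.
Proof.
have x0 := rnorm_ge0 x; have y0 := rnorm_ge0 y; have xy0 := rnorm_ge0 (x + y).
have := ler_rnormD (x + y) (- y); rewrite addrK rnormN => hx.
have := ler_rnormD (y + x) (- x); rewrite addrK rnormN [y + x]addrC => hy.
have hD := ler_rnormD x y.
by apply/andP; split; nra.
Qed.

Lemma rnormB_sqr_bounds x y :
  (N x - N y) ^+ 2 <= N (x - y) ^+ 2 <= (N x + N y) ^+ 2.
Proof. by have := rnormD_sqr_bounds x (- y); rewrite rnormN. Qed.

(** * The functions p_y and the parallelogram law *)

Definition parallelogram_law :=
  forall x y, N (x + y) ^+ 2 + N (x - y) ^+ 2 = 2 * (N x ^+ 2 + N y ^+ 2).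

(** The argument of the square root is nonnegative: 2 y is the difference of
    x + y and x - y, so their norms a and b satisfy 2 <= a + b, and then
    a^2 + b^2 >= 2 (a + b) - 2 >= 2. *)
Lemma pfun_sqr y x : N y = 1 ->
  pfun toR y x ^+ 2 = (N (x + y) ^+ 2 + N (x - y) ^+ 2) / 2 - 1.
Proof.
move=> y1; rewrite sqr_sqrtr //.
have := ler_rnormD (x + y) (y - x).
have -> : x + y + (y - x) = ofR 2 *: y.
  by rewrite [x + y]addrC addrACA subrr addr0 rmorph_nat scaler_nat mulr2n.
rewrite rnormZr y1 [N (y - x)]rnormB normr_nat mulr1 => sum2.
have := sqr_ge0 (N (x + y) - 1); have := sqr_ge0 (N (x - y) - 1); lra.
Qed.

(** Homogeneity transports the comparison of p_y with the norm to the points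
    t x with t large, where the contribution of y becomes negligible. *)
Lemma homogeneous_pfun y : N y = 1 -> homogeneous toR (pfun toR y) ->
  forall x, pfun toR y x = N x.
Proof.
move=> y1 hom x; apply/eqP; rewrite -(@eqrXn2 _ 2) ?sqrtr_ge0 ?rnorm_ge0 //.
rewrite -subr_eq0 -normr_le0.
(* With m = t N(x), the triangle inequality gives
   (m - 1)^2 <= N(t x + y)^2, N(t x - y)^2 <= (m + 1)^2, hence
   t^2 |p_y(x)^2 - N(x)^2| <= 2 m = 2 t N(x). *)
apply: (@natmul_bounded_le0 _ _ (2 * N x)) => n.
set t : R := n.+1%:R; have t0 : 0 < t by rewrite ltr0Sn.
have := rnormB_sqr_bounds (ofR t *: x) y.
have := rnormD_sqr_bounds (ofR t *: x) y.
have := pfun_sqr (ofR t *: x) y1.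
rewrite hom toR_norm_ofR rnormZr y1 gtr0_norm // => sq.
move=> /andP[l1 u1] /andP[l2 u2].
rewrite -(ler_pM2l t0) mulrCA -expr2.
rewrite -[X in _ * X <= _]gtr0_norm ?exprn_gt0 // -normrM.
by rewrite ler_norml; apply/andP; split; lra.
Qed.

(** Every pair (x, y) with y <> 0 is a multiple of one whose second member is a
    unit vector, and the parallelogram law is homogeneous of degree 2. *)
Lemma pfun_parallelogram :
    (forall y, N y = 1 -> forall x, pfun toR y x = N x) ->
  parallelogram_law.
Proof.
move=> pN x y; have [/rnorm_eq0 ->|y0] := eqVneq (N y) 0.
  by rewrite subr0 addr0 rnorm0; ring.
have r0 : 0 < N y by rewrite lt_def y0 rnorm_ge0.
have s0 : 0 < (N y)^-1 by rewrite invr_gt0.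
have Ny1 : N (ofR (N y)^-1 *: y) = 1 by rewrite rnormZr gtr0_norm // mulVf.
have := pfun_sqr (ofR (N y)^-1 *: x) Ny1.
rewrite pN // -scalerDr -scalerBr !rnormZr.
rewrite gtr0_norm // => /(congr1 (fun u => u * N y ^+ 2)).
have -> : ((N y)^-1 * N x) ^+ 2 * N y ^+ 2 = N x ^+ 2 by field.
by move=> ->; field.
Qed.

Lemma parallelogram_pfun : parallelogram_law ->
  forall y, N y = 1 -> forall x, pfun toR y x = N x.
Proof.
move=> par y y1 x; apply/eqP; rewrite -(@eqrXn2 _ 2) ?sqrtr_ge0 ?rnorm_ge0 //.
by rewrite pfun_sqr // par y1; apply/eqP; field.
Qed.

Lemma inner_product_parallelogram (conj : K -> K) :
  induced_by_inner_product conj X -> parallelogram_law.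
Proof.
case=> dot dotE x y; apply: (fmorph_inj ofR).
rewrite rmorphM rmorph_nat !rmorphD !rmorphXn !ofR_rnorm !dotE.
rewrite !linearDl !linearDr !linearNl !linearNr /=.
by ring.
Qed.

(** * The polar form *)

(** For a norm induced by an inner product, this is the real part of the inner
    product. *)
Definition polar x y : R := (N (x + y) ^+ 2 - N (x - y) ^+ 2) / 4.

Lemma polarC x y : polar x y = polar y x.
Proof. by rewrite /polar [x + y]addrC rnormB. Qed.

Lemma polarxx x : polar x x = N x ^+ 2.
Proof.
rewrite /polar subrr rnorm0.
have -> : x + x = ofR 2 *: x by rewrite rmorph_nat scaler_nat mulr2n.
by rewrite rnormZr normr_nat; field.
Qed.

(** Combine the parallelogram laws of the pairs (x + y, z), (x - y, z),
    (z + y, x) and (z - y, x) with signs +, -, +, -: up to the sign of their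
    argument, the unwanted norms occur twice with opposite signs. *)
Lemma polarDl : parallelogram_law ->
  forall y, {morph polar^~ y : x z / x + z}.
Proof.
move=> par y x z; rewrite /polar.
have := par (x + y) z; have := par (x - y) z.
have := par (z + y) x; have := par (z - y) x.
have -> : z - y - x = - (x + y - z) by rewrite opprB opprD addrA addrAC.
have -> : z + y - x = - (x - y - z) by rewrite !opprB addrA.
rewrite !rnormN.
have -> : x + z + y = x + y + z by rewrite addrAC.
have -> : x + z - y = x - y + z by rewrite addrAC.
have -> : z + y + x = x + y + z by rewrite addrC [z + y]addrC addrA.
have -> : z - y + x = x - y + z by rewrite addrC [z - y]addrC addrA.
by lra.
Qed.

Lemma polarNl x y : polar (- x) y = - polar x y.
Proof.
have e1 : - x + y = - (x - y) by rewrite opprB addrC.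
have e2 : - x - y = - (x + y) by rewrite opprD.
by rewrite /polar e1 e2 !rnormN; ring.
Qed.

Lemma polar_bound x y : `|polar x y| <= N x * N y.
Proof.
have /andP[l1 u1] := rnormD_sqr_bounds x y.
have /andP[l2 u2] := rnormB_sqr_bounds x y.
by rewrite ler_norml /polar; apply/andP; split; lra.
Qed.

(** Additivity alone gives rational multiples; the bound of [polar_bound] is
    what extends this to real ones. *)
Lemma polarZl : parallelogram_law ->
  forall t x y, polar (ofR t *: x) y = t * polar x y.
Proof.
move=> par t x y.
have := @additive_bounded_linear _ (fun s => polar (ofR s *: x) y) (N x * N y).
rewrite rmorph1 scale1r; apply => [r s|s].
  by rewrite rmorphD scalerDl polarDl.
by rewrite (le_trans (polar_bound _ _)) // rnormZr -mulrA mulrC.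
Qed.

(** The construction of the inner product is the only step that depends on the
    scalar field, so it is left as a hypothesis here. *)
Lemma pfun_tfae (conj : K -> K) :
    (parallelogram_law -> induced_by_inner_product conj X) ->
  [<-> forall y, N y = 1 -> homogeneous toR (pfun toR y);
       forall y, N y = 1 -> forall x, pfun toR y x = N x;
       induced_by_inner_product conj X].
Proof.
move=> par_ind; tfae.
- by move=> hom y y1 x; apply: homogeneous_pfun => //; apply: hom.
- by move=> pN; apply/par_ind/pfun_parallelogram.
- move=> /inner_product_parallelogram par y y1 l x.
  by rewrite !(parallelogram_pfun par y1) rnormZ.
Qed.

End RealScalars.

(** * The theorem of Jordan and von Neumann *)

(** Linearity in the second argument up to [conj] follows from linearity in
    the first by hermitian symmetry, and positive definiteness is that of the
    norm. *)
Lemma hermitian_inner_product (K : numFieldType) (conj : {rmorphism K -> K})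
    (X : normedModType K) (f : X -> X -> K) :
    (forall w, scalar (f^~ w)) -> (forall x y, f x y = conj (f y x)) ->
    (forall x, `|x| ^+ 2 = f x x) ->
  induced_by_inner_product conj X.
Proof.
move=> flin fherm fnorm.
have fDl w : {morph f^~ w : u v / u + v}.
  by move=> u v; have := flin w 1 u v; rewrite scale1r mul1r.
have f0l w : f 0 w = 0 by apply: (addrI (f 0 w)); rewrite -fDl !addr0.
have fZl w a u : f (a *: u) w = a * f u w.
  by have := flin w a u 0; rewrite f0l !addr0.
have fBl w : zmod_morphism (f^~ w).
  by move=> u v; rewrite fDl -scaleN1r fZl mulN1r.
have fBr u : zmod_morphism (f u).
  by move=> v w; rewrite fherm fBl rmorphB -!fherm.
have fZr u : scalable_for (conj \; *%R) (f u).
  by move=> a v; rewrite fherm fZl rmorphM -fherm.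
have f_pos u : u != 0 -> 0 < f u u.
  by rewrite -fnorm -normr_gt0 => u0; rewrite exprn_gt0.
have f_herm u v : f u v = (-1) ^+ false * conj (f v u) by rewrite mul1r.
pose B := isBilinear.Build _ _ _ _ *%R (conj \; *%R) f fBl fBr
  (fun w a u => fZl w a u) fZr.
pose H := isHermitianSesquilinear.Build _ _ false conj f f_herm.
pose D := isDotProduct.Build _ _ f f_pos.
pose dot : {dot X for conj} := HB.pack f B H D.
by exists dot.
Qed.

Lemma real_jordan_von_neumann (R : realType) (X : normedModType R) :
  parallelogram_law idfun X -> induced_by_inner_product idfun X.
Proof.
move=> par.
have polarZ := @polarZl R R idfun idfun (fun _ => erefl) (fun _ _ => erefl)
  (fun _ => erefl) X par.
apply: (@hermitian_inner_product _ idfun X (polar idfun (X := X))).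
- by move=> w a u v; rewrite polarDl // polarZ.
- by move=> x y; rewrite polarC.
- by move=> x; rewrite (@polarxx R R idfun idfun).
Qed.

Section Complex.
Variables (R : realType) (X : normedModType R[i]).
Local Notation Re := (@complex.Re R).
Local Notation ofR := (real_complex R).
Local Notation P := (polar Re (X := X)).
Local Notation I := ('i%C : R[i]).

Lemma real_complexK : cancel ofR Re. Proof. by []. Qed.

Lemma Re_nnegK (k : R[i]) : 0 <= k -> ofR (Re k) = k.
Proof. by case: k => a b; rewrite lecE /= => /andP[/eqP -> _]. Qed.

Lemma polar_rot x y : P (I *: x) (I *: y) = P x y.
Proof.
rewrite /polar -scalerDr -scalerBr !(rnormZ real_complexK Re_nnegK).
by rewrite normc_def /= expr0n expr1n add0r sqrtr1 !mul1r.
Qed.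

(** Applying the isometry x |-> i x to both arguments preserves the polar form,
    and applying it twice to the first one changes the sign. *)
Lemma polar_skew x y : P (I *: x) y = - P x (I *: y).
Proof. by rewrite -polar_rot scalerA -expr2 sqr_i scaleN1r polarNl. Qed.

Lemma polar_rot0 x : P x (I *: x) = 0.
Proof. by have := polar_skew x x; rewrite polarC; lra. Qed.

(** The imaginary part of an inner product that is conjugate-linear in its
    second argument is the real part evaluated at (x, i y). *)
Definition hpolar (x y : X) : R[i] := (P x y +i* P x (I *: y))%C.

Lemma hpolarDl : parallelogram_law Re X ->
  forall w, {morph hpolar^~ w : x y / x + y}.
Proof. by move=> par w x y; rewrite /hpolar !(polarDl par). Qed.

Lemma hpolarZl : parallelogram_law Re X ->
  forall w k x, hpolar (k *: x) w = k * hpolar x w.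
Proof.
move=> par w k x.
rewrite [in LHS](complexE k) scalerDl -scalerA hpolarDl // /hpolar.
rewrite !polar_skew !(polarZl real_complexK Re_nnegK (@ler0c R)) //.
rewrite [I *: (I *: w)]scalerA -expr2 sqr_i scaleN1r.
rewrite [P x (- w)]polarC polarNl [P w x]polarC.
by case: k => a b /=; simpc.
Qed.

Lemma complex_jordan_von_neumann : parallelogram_law Re X ->
  induced_by_inner_product Num.conj X.
Proof.
move=> par; apply: (@hermitian_inner_product _ Num.conj X hpolar).
- by move=> w a u v; rewrite hpolarDl // hpolarZl.
- move=> x y; rewrite /hpolar [RHS]/= [P y x]polarC [P y _]polarC polar_skew.
  by rewrite -[RHS]/(conjc _) /= opprK.
- move=> x; rewrite /hpolar polar_rot0 (polarxx real_complexK Re_nnegK (@ler0c R)).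
  by rewrite -(ofR_rnorm Re_nnegK) -rmorphXn.
Qed.
End Complex.

Theorem theorem5 (R : realType) :
  (forall X : normedModType R,
    let toR : R -> R := idfun in
    [<-> (forall y : X, rnorm toR y = 1 -> homogeneous toR (pfun toR y));
         (forall y : X, rnorm toR y = 1 ->
            forall x : X, pfun toR y x = rnorm toR x);
         induced_by_inner_product idfun X])
  /\
  (forall X : normedModType R[i],
    let toR : R[i] -> R := @complex.Re R in
    [<-> (forall y : X, rnorm toR y = 1 -> homogeneous toR (pfun toR y));
         (forall y : X, rnorm toR y = 1 ->
            forall x : X, pfun toR y x = rnorm toR x);
         induced_by_inner_product Num.conj X]).
Proof.
split=> X toR.
  apply: (@pfun_tfae R R idfun idfun) => //.
  exact: real_jordan_von_neumann.
apply: (pfun_tfae (@real_complexK R) (@Re_nnegK R)); first exact: ler0c.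
exact: complex_jordan_von_neumann.
Qed.
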